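(* Let $t,s$ be nonnegative integers and let $m\ge 2$ be an integer. Suppose that one of the following holds. (i) The pairs $(A_i,B_i)$, $1\le i\le m$, are pairs of finite sets satisfying $|A_i\cap B_i|\le t$ for all $i$ and $|A_i\cap B_j|>t+s$ for all $i\ne j$; put $a_i=|A_i|$ and $b_i=|B_i|$. (ii) The pairs $(A_i,B_i)$, $1\le i\le m$, are pairs of subspaces of a finite-dimensional vector space over an arbitrary field satisfying $\dim(A_i\cap B_i)\le t$ for all $i$ and $\dim(A_i\cap B_j)>t+s$ for all $i\ne j$; put $a_i=\dim A_i$ and $b_i=\dim B_i$. Put $\alpha_i=a_i-t$ and $\beta_i=b_i-t$. Then, in either case, for all nonnegative integers $p,q$ with $p+q\le s$, $$\sum_{i=1}^{m}\frac{H_{p,q}(\alpha_i,\beta_i)}{\binom{\alpha_i+\beta_i}{\alpha_i-p+q}}\le 1.$$ In particular, for every nonnegative integer $r$ with $2r\le s$, $$\sum_{i=1}^{m}\frac{\sum_{j=0}^{r}\binom{\alpha_i}{j}\binom{\beta_i}{j}}{\binom{\alpha_i+\beta_i}{\alpha_i}}\le 1.$$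
   Context: For nonnegative integers $p,q$ and positive integers $a,b$, $$H_{p,q}(a,b)=\sum_{\ell=0}^{\min(p,q)}\binom{a}{p-\ell}\binom{b}{q-\ell}.$$ The hypotheses with $m\ge2$ force $\alpha_i,\beta_i\ge s+1$. *)

(* Defs.v *)
From HB Require Import structures.
From mathcomp Require Import all_boot all_order all_algebra finmap.
Set Implicit Arguments.
Unset Strict Implicit.
Unset Printing Implicit Defensive.

(* H_{p,q}(a,b); the index l is at most min(p,q), so the subtractions in the
   lower entries are never truncated. *)
Definition Hpq (p q a b : nat) : nat :=
  \sum_(l < (minn p q).+1) 'C(a, p - l) * 'C(b, q - l).

(* Main.v *)
Require Import Defs.
From HB Require Import structures.
From mathcomp Require Import all_boot all_order all_algebra finmap.
From mathcomp Require Import zify ring.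
Set Implicit Arguments.
Unset Strict Implicit.
Unset Printing Implicit Defensive.
Import Order.TTheory GRing.Theory Num.Theory passmx.
Local Open Scope ring_scope.

(** The weights are absorbed first: fixing bases of A_i and B_i and moving p - l
basis vectors of A_i to B_i and q - l basis vectors of B_i to A_i gives
H_{p,q}(a_i, b_i) new pairs of total dimension a_i + b_i, and all these pairs
together satisfy A' ∩ B' = 0 on the diagonal and A' ∩ B' <> 0 off it.  (One
gets t = 0 by cutting with a generic subspace of codimension t over an infinite
extension of the field; sets become coordinate subspaces.)

So it suffices to show that the sum of 1 / C(a_i + b_i, a_i) is at most 1 for
such pairs in a space V of dimension N.  Let I be the ideal of the exterior
algebra formed by the w with v ∧ ω(B_i) ∧ w = 0 for all i and v in A_i; it
contains the ω(A_i).  For sets, I_k is spanned by an up-set of the Boolean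
lattice, and the i-th term is the probability that a random maximal chain enters
it from A_i.  Accordingly, the refined local LYM inequality
  (N - k + 1) dim I_(k-1) + sum_i a_i C(N - a_i - b_i, k - a_i) <= k dim I_k
is proved by splitting I along the vectors of a flag that is transversal to all
the A_i + B_i, and divided by k C(N, k) and summed over k. *)

(** * The exterior algebra and its multiplication operators *)

Lemma linfun_linearE (R : nzRingType) (aT rT : vectType R) (f : aT -> rT) :
  linear f -> linfun f =1 f.
Proof.
move=> lin_f.
pose g : {linear aT -> rT} :=
  HB.pack f (GRing.isLinear.Build R aT rT *:%R f lin_f).
exact: (lfunE g).
Qed.

(* [L p] plays the role of the [p]-th exterior power of a space of dimension
   [N], [W] that of the exterior algebra and [E v] that of the left
   multiplication by [v]; only the properties below are needed. *)
Record exterior (F : fieldType) (V : lmodType F) (N : nat) (W : vectType F)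
  (E : V -> 'End(W)) (L : nat -> {vspace W}) : Prop := Exterior {
  ext_linear : linear E;
  ext_sqr : forall v w, E v (E v w) = 0;
  ext_deg : forall v p w, w \in L p -> E v w \in L p.+1;
  ext_one : exists2 w, w \in L 0%N & w != 0;
  ext_top : (\dim (L N) <= 1)%N;
  ext_high : forall p, (N < p)%N -> L p = 0%VS;
  ext_socle : forall p w, (p < N)%N -> w \in L p ->
    (forall v, E v w = 0) -> w = 0 }.

(** Induction on [N]: with e0 the new basis vector, a pair [(z1, z2)] stands for z1 + e0 ∧ z2, and
    [act] is the product by hd e0 + tl; the sign comes from moving tl past e0. *)
Lemma exterior_exists (F : fieldType) (N : nat) :
  exists (W : vectType F) (E : 'rV[F]_N -> 'End(W)) (L : nat -> {vspace W}),
    exterior N E L.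
Proof.
elim: N => [|N [W [E [L [Elin Esqr Edeg Eone Etop Ehigh Esoc]]]]].
  exists F^o, (fun=> 0), (fun p => if p == 0%N then fullv else 0%VS).
  split=> //=.
  - by move=> a u v; rewrite scaler0 addr0.
  - by move=> v w; rewrite !zero_lfunE.
  - by move=> v p w _; rewrite zero_lfunE mem0v.
  - by exists 1; rewrite ?memvf ?oner_neq0.
  - by rewrite dimvf.
  - by case.
pose hd (v : 'rV[F]_(1 + N)) := v 0 0.
pose tl (v : 'rV[F]_(1 + N)) := rsubmx v.
pose act (v : 'rV[F]_(1 + N)) (z : W * W) : W * W :=
  (E (tl v) z.1, hd v *: z.1 - E (tl v) z.2).
have act_lin v : linear (act v).
  move=> a [x1 x2] [y1 y2]; rewrite /act /=; congr pair.
    by rewrite linearP.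
  change (hd v *: (a *: x1 + y1) - E (tl v) (a *: x2 + y2) =
    a *: (hd v *: x1 - E (tl v) x2) + (hd v *: y1 - E (tl v) y2)).
  rewrite [E _ (_ + _)]linearP scalerDr scalerBr !scalerA [hd v * a]mulrC.
  by rewrite opprD addrACA.
have tl_lin : linear tl by move=> a u v; rewrite /tl linearP.
have hd_lin a u v : hd (a *: u + v) = a * hd u + hd v by rewrite /hd !mxE.
have fst_lin : linear (fun z : W * W => z.1) by [].
have snd_lin : linear (fun z : W * W => z.2) by [].
pose L1 p : {vspace W} := if p is q.+1 then L q else 0%VS.
pose L' p : {vspace (W * W)%type} :=
  ((linfun (fun z : W * W => z.1) @^-1: L p) :&:
   (linfun (fun z : W * W => z.2) @^-1: L1 p))%VS.
have memL' p z : (z \in L' p) = (z.1 \in L p) && (z.2 \in L1 p).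
  rewrite memv_cap -!memv_preim (linfun_linearE fst_lin).
  by rewrite (linfun_linearE snd_lin).
exists (W * W)%type, (fun v => linfun (act v)), L'; split.
- move=> a u v; apply/lfunP=> z; rewrite add_lfunE scale_lfunE.
  rewrite !linfun_linearE // /act tl_lin Elin hd_lin; case: z => z1 z2 /=.
  rewrite !add_lfunE !scale_lfunE; congr pair.
  change ((a * hd u + hd v) *: z1 - (a *: E (tl u) z2 + E (tl v) z2) =
    a *: (hd u *: z1 - E (tl u) z2) + (hd v *: z1 - E (tl v) z2)).
  by rewrite scalerDl -scalerA scalerBr opprD addrACA.
- move=> v z; rewrite !linfun_linearE // /act /= Esqr; congr pair.
  by rewrite linearB /= Esqr subr0 linearZ subrr.
- move=> v p z; rewrite !memL' linfun_linearE // => /andP[z1 z2] /=.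
  rewrite Edeg //=; case: p z1 z2 => [|p] z1 z2.
    by move: z2; rewrite memv0 => /eqP->; rewrite linear0 subr0 memvZ.
  by rewrite memvB ?memvZ // Edeg.
- have [w w0 wn0] := Eone.
  exists (w, 0); first by rewrite memL' /= w0 mem0v.
  by apply: contraNneq wn0 => -[->].
- have sub : (L' N.+1 <= linfun (fun w : W => (0, w) : W * W) @: L N)%VS.
    apply/subvP=> -[z1 z2]; rewrite memL' /= Ehigh // memv0.
    move=> /andP[/eqP-> z2L].
    have lin2 : linear (fun w : W => (0, w) : W * W).
      by move=> a x y; congr pair; rewrite /= scaler0 addr0.
    by rewrite -(linfun_linearE lin2) memv_img.
  apply: leq_trans (dimvS sub) _; apply: leq_trans Etop.
  rewrite -(limg_ker_dim (linfun (fun w : W => (0, w) : W * W)) (L N)).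
  exact: leq_addl.
- case=> // p Np; apply/eqP; rewrite -subv0; apply/subvP=> -[z1 z2].
  by rewrite memL' /= !Ehigh ?(ltnW Np) // ?memv0.
- move=> p [z1 z2] pN; rewrite memL' /= => /andP[z1L z2L] kill.
  (* Multiplying by e0 alone isolates [z1]; the vectors of the old space then deal with [z2] by
     induction. *)
  have z10 : z1 = 0.
    have := kill (row_mx 1%:M 0); rewrite linfun_linearE // /act /tl /hd /=.
    rewrite row_mxKr; have -> : E 0 = 0.
      by have := Elin (-1) 0 0; rewrite scaler0 add0r scaleN1r addNr.
    case=> _; rewrite zero_lfunE subr0.
    have -> : (row_mx 1%:M 0 : 'rV[F]_(1 + N)) 0 0 = 1.
      have -> : (0 : 'I_(1 + N)) = lshift N 0 by apply: val_inj.
      by rewrite row_mxEl mxE eqxx.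
    by rewrite scale1r.
  rewrite z10; congr pair; case: p pN z1L z2L => [|p] pN z1L z2L.
    by apply/eqP; rewrite -memv0.
  apply: (Esoc p) => // v.
  have := kill (row_mx (0 : 'rV[F]_1) v).
  rewrite linfun_linearE // /act /tl /hd z10 /=.
  by rewrite row_mxKr => -[_ /eqP]; rewrite scaler0 sub0r oppr_eq0 => /eqP.
Qed.

Section Wedge.

Variables (F : fieldType) (V W : vectType F) (N : nat).
Variables (E : V -> 'End(W)) (L : nat -> {vspace W}).
Hypothesis extE : exterior N E L.

Definition wedge (s : seq V) : 'End(W) :=
  foldr (fun v f => (E v \o f)%VF) \1%VF s.

Lemma wedge_nil w : wedge [::] w = w.
Proof. exact: id_lfunE. Qed.

Lemma wedge_cons v s w : wedge (v :: s) w = E v (wedge s w).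
Proof. exact: comp_lfunE. Qed.

Lemma wedge_cat s t w : wedge (s ++ t) w = wedge s (wedge t w).
Proof.
by elim: s => [|v s IHs]; rewrite ?wedge_nil // cat_cons !wedge_cons IHs.
Qed.

Lemma ext_anticomm v w x : E v (E w x) = - E w (E v x).
Proof.
have Elin := ext_linear extE; have Esqr := ext_sqr extE.
have EE u1 u2 y : E (u1 + u2) y = E u1 y + E u2 y.
  by rewrite -[u1]scale1r Elin add_lfunE !scale1r.
have := Esqr (v + w) x; rewrite !EE !linearD /= !Esqr add0r addr0.
by move/eqP; rewrite addr_eq0 => /eqP.
Qed.

Lemma ext_kill_span s w v :
  {in s, forall u, E u w = 0} -> v \in <<s>>%VS -> E v w = 0.
Proof.
move=> sw vs; have lin : linear (fun u => E u w).
  by move=> a u1 u2; rewrite (ext_linear extE) add_lfunE scale_lfunE.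
have /subvP/(_ v vs) : (<<s>> <= lker (linfun (fun u => E u w)))%VS.
  by apply/span_subvP=> u us; rewrite memv_ker linfun_linearE // sw.
by rewrite memv_ker linfun_linearE // => /eqP.
Qed.

Lemma ext_wedge v s w :
  E v (wedge s w) = (-1) ^+ size s *: wedge s (E v w).
Proof.
elim: s => [|u s IHs]; first by rewrite !wedge_nil scale1r.
rewrite !wedge_cons ext_anticomm IHs linearZ /= exprS mulN1r.
by rewrite scaleNr.
Qed.

Lemma wedge_ext v s w :
  wedge s (E v w) = (-1) ^+ size s *: E v (wedge s w).
Proof. by rewrite ext_wedge scalerA -expr2 sqrr_sign scale1r. Qed.

Lemma wedge_kill v s w : E v w = 0 -> E v (wedge s w) = 0.
Proof. by move=> vw; rewrite ext_wedge vw linear0 scaler0. Qed.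

Lemma wedge_span0 v s w : v \in <<s>>%VS -> E v (wedge s w) = 0.
Proof.
apply: ext_kill_span => {v}; elim: s => // u s IHs v.
rewrite inE wedge_cons => /predU1P[->|/IHs vs]; first exact: (ext_sqr extE).
by rewrite ext_anticomm vs linear0 oppr0.
Qed.

Lemma wedge_nfree s w : ~~ free s -> wedge s w = 0.
Proof.
elim: s => [|v s IHs]; first by rewrite nil_free.
rewrite free_cons negb_and negbK wedge_cons => /orP[/wedge_span0|/IHs ->] //.
exact: linear0.
Qed.

Lemma wedge_deg s p w : w \in L p -> wedge s w \in L (size s + p)%N.
Proof.
move=> wp; elim: s => [|v s IHs]; first by rewrite wedge_nil.
by rewrite wedge_cons (ext_deg extE).
Qed.

Lemma ext_socle_span s p w : (p < N)%N -> w \in L p -> (<<s>> = fullv)%VS ->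
  {in s, forall u, E u w = 0} -> w = 0.
Proof.
move=> pN wp sV sw; apply: (ext_socle extE pN wp) => v.
by apply: (ext_kill_span sw); rewrite sV memvf.
Qed.

(** Below the top degree the socle property yields some [v] in [s] that does not kill [w]. Moving
    [v] from [s] to [t] and replacing [w] by [E v w] shortens [s] and changes the product by a sign
    only. *)
Lemma wedge_neq0 s t p w : w \in L p -> w != 0 -> (size s + p = N)%N ->
  (<<s ++ t>> = fullv)%VS -> {in t, forall u, E u w = 0} -> wedge s w != 0.
Proof.
move: {2}(size s) (erefl (size s)) => n.
elim: n s t p w => [|n IHn] s t p w sn wp wn0 spN sV tw.
  by case: s sn {spN sV} => // _; rewrite wedge_nil.
have [/hasP[v vs vwn0]|/hasPn sw] := boolP (has (fun v => E v w != 0) s);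
  last first.
  have /eqP[] := wn0; apply: (ext_socle_span _ wp sV); first by lia.
  by move=> u; rewrite mem_cat => /orP[/sw|/tw //]; rewrite negbK => /eqP.
case/splitPr: vs sn spN sV => s1 s2; rewrite size_cat /= => sn spN sV.
have : wedge (s1 ++ s2) (E v w) != 0.
  apply: (IHn _ (v :: t) p.+1) => //; rewrite ?size_cat ?(ext_deg extE) //;
    try by lia.
    rewrite -sV; apply: eq_span => u; rewrite !(mem_cat, inE).
    by do !case: (_ \in _); rewrite ?orbT ?orbF.
  move=> u; rewrite inE => /predU1P[->|/tw uw]; first exact: (ext_sqr extE).
  by rewrite ext_anticomm uw linear0 oppr0.
rewrite !wedge_cat wedge_cons ext_wedge linearZ /=.
by rewrite scaler_eq0 negb_or signr_eq0.
Qed.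

End Wedge.

(** * The refined local LYM inequality *)

Lemma memv_bigcap_seq (F : fieldType) (W : vectType F) (I : Type) (S : seq I)
    (U : I -> {vspace W}) w :
  (w \in \bigcap_(i <- S) U i)%VS = all (fun i => w \in U i) S.
Proof.
rewrite -big_all; apply: (big_morph (fun X : {vspace W} => w \in X)).
  by move=> X Y; rewrite memv_cap.
exact: memvf.
Qed.

(** Cutting by the kernel of [f i] loses at least one dimension because of [g i], and keeps the
    other [g j] for the next cuts. *)
Lemma capv_ker_dim (F : fieldType) (W : vectType F) (I : eqType) (S : seq I)
    (G : {vspace W}) (f : I -> 'End(W)) (g : I -> W) :
    uniq S -> {in S, forall i, g i \in G} -> {in S, forall i, f i (g i) != 0} ->
    {in S &, forall i j, i != j -> f i (g j) = 0} ->
  (\dim (G :&: \bigcap_(i <- S) lker (f i))%VS + size S <= \dim G)%N.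
Proof.
elim: S G => [|i S IHS] G; first by rewrite big_nil capvf addn0.
move=> /= /andP[iS uS] gG fg0 fg; rewrite big_cons capvA.
have : (\dim ((G :&: lker (f i)) :&: \bigcap_(j <- S) lker (f j))%VS + size S
         <= \dim (G :&: lker (f i)))%N.
  apply: IHS => // [j jS | j jS | j k jS kS].
  - rewrite memv_cap gG ?inE ?jS ?orbT // memv_ker fg ?inE ?eqxx ?jS ?orbT //.
    by apply: contraNneq iS => ->.
  - by rewrite fg0 // inE jS orbT.
  - by apply: fg; rewrite inE ?jS ?kS orbT.
suff : (0 < \dim (f i @: G))%N by rewrite -(limg_ker_dim (f i) G); lia.
have : f i (g i) \in (f i @: G)%VS by rewrite memv_img // gG ?inE ?eqxx.
apply: contraTT; rewrite -leqNgt leqn0 dimv_eq0 => /eqP ->.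
by rewrite memv0 fg0 ?inE ?eqxx.
Qed.

(** The test is needed since truncated subtraction would give ['C(d, 0) = 1] when [r < b]. *)
Definition shift_bin d r b := if (b <= r)%N then 'C(d, r - b) else 0%N.

Lemma shift_binS d r b : shift_bin d.+1 r b =
  (shift_bin d r b + (if r is q.+1 then shift_bin d q b else 0))%N.
Proof.
rewrite /shift_bin; case: r => [|r]; first by case: b => [|b] //=; rewrite !bin0.
case: (ltngtP b r.+1) => [br|br|->]; last by rewrite subnn !bin0 ltnn.
  by rewrite -ltnS br subSn // binS addnC.
by rewrite leqNgt (ltnW br).
Qed.

(* Degrees are counted from the top: [J0 r] is I_(N - r).  The induction is on
   the number [x] of operators [e y] not yet used.  Splitting along [e x]
   replaces [J] by the shifted images [e x @: J r.+1] and by the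
   [J r :&: lker (e x)].  The subspace [G r] of [J r] still contains all the
   products [e y (J r.+1)]; its codimension counts the indices [i] with
   [x < na i + nb i], which have already been split off. *)
Section Flux.

Variables (F : fieldType) (W : vectType F) (I : finType) (N : nat).
Variables (na nb : I -> nat) (e : nat -> 'End(W)).
Variables (beta : I -> 'End(W)) (al : I -> nat -> W) (J0 : nat -> {vspace W}).

Local Notation nn i := (na i + nb i)%N.

Hypothesis e_anticomm : forall x y w, e x (e y w) = - e y (e x w).
Hypothesis e_sqr : forall x w, e x (e x w) = 0.
Hypothesis alS : forall i x, (x < N)%N -> al i x = e x (al i x.+1).
Hypothesis beta_al : forall i j, i != j -> beta i (al j (nn i)) = 0.
Hypothesis beta_al_neq0 : forall i, beta i (al i (nn i)) != 0.
Hypothesis J0_socle : forall r w, (0 < r)%N -> w \in J0 r ->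
  (forall z, (z < N)%N -> e z w = 0) -> w = 0.
Hypothesis beta_kill : forall i w y, w \in J0 (nb i).+1 ->
  (forall z, (nn i <= z < N)%N -> e z w = 0) -> beta i (e y w) = 0.

Lemma flux x (J G : nat -> {vspace W}) : (x <= N)%N ->
  (forall r, (J r <= J0 r)%VS) ->
  (forall r z w, (x <= z < N)%N -> w \in J r -> e z w = 0) ->
  (forall r, (G r <= J r)%VS) ->
  (forall r y w, (y < x)%N -> w \in J r.+1 -> e y w \in G r) ->
  (forall y w, (y < x)%N -> w \in J 0%N -> e y w = 0) ->
  (forall i, (nn i <= x)%N -> al i x \in G (x - na i)%N) ->
  forall r, (r.+1 * \dim (J r.+1)
     + \sum_(i | (nn i <= x)%N) na i * shift_bin (x - nn i) r (nb i)
     <= (x - r) * \dim (G r))%N.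
Proof.
elim: x J G => [|x IHx] J G xN JJ0 Jkill GJ eJ eJ0 alG r.
  (* At stage 0 every [e z] kills [J], so [J r.+1] vanishes, and [nn i <= 0] forces [na i = 0]. *)
  rewrite sub0n mul0n leqn0 addn_eq0 sum_nat_eq0 muln_eq0 /= dimv_eq0.
  apply/andP; split.
    rewrite -subv0; apply/subvP=> w wJ; rewrite memv0; apply/eqP.
    apply: (@J0_socle r.+1) => // [|z zN]; last exact: (Jkill r.+1).
    exact: (subvP (JJ0 _)).
  apply/forallP=> i; apply/implyP; rewrite leqn0 addn_eq0 => /andP[/eqP-> _].
  by [].
(* [S r] lists the indices that enter the sum exactly at stage [x.+1] with a nonzero binomial in
   degree [r]. By [beta_kill], their [beta i] vanish on all [e y w] with [w] in [J r.+1], so [G' r]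
   still contains these products. *)
pose S r := [seq i <- enum I | (nn i == x.+1) && (nb i == r)].
pose G' r := (G r :&: \bigcap_(i <- S r) lker (beta i))%VS.
have memG' q w : w \in G q ->
    (forall i, nn i = x.+1 -> nb i = q -> beta i w = 0) -> w \in G' q.
  move=> wG wb; rewrite memv_cap wG memv_bigcap_seq; apply/allP=> i.
  by rewrite mem_filter memv_ker => /andP[/andP[/eqP ? /eqP ?] _]; rewrite wb.
have eJG' q y w : (y < x.+1)%N -> w \in J q.+1 -> e y w \in G' q.
  move=> yx wJ; apply: memG' => [|i ni bi]; first exact: eJ.
  apply: beta_kill; first by rewrite bi; exact: (subvP (JJ0 _) _ wJ).
  by move=> z; rewrite ni => zx; apply: Jkill wJ.
have alG' i : (nn i <= x)%N -> al i x.+1 \in G' (x - na i).+1.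
  move=> nix; apply: memG' => [|j nj bj]; last first.
    rewrite -nj; apply: beta_al; apply: contraTneq nix => <-.
    by rewrite nj ltnn.
  have := alG i (leqW nix); rewrite subSn //; apply: leq_trans nix.
  exact: leq_addr.
have IH0 := IHx (fun q => e x @: J q.+1)%VS (fun q => e x @: G' q.+1)%VS.
have IH1 := IHx (fun q => J q :&: lker (e x))%VS
  (fun q => G' q :&: lker (e x))%VS.
have {}IH0 q : (q.+1 * \dim (e x @: J q.+2)
     + \sum_(i | (nn i <= x)%N) na i * shift_bin (x - nn i) q (nb i)
     <= (x - q) * \dim (e x @: G' q.+1)%VS)%N.
  apply: IH0 => [|{}q|{}q z w|{}q|{}q y w yx|y w yx|i nix]; first exact: ltnW.
  - apply/subvP=> _ /memv_imgP[w wJ ->]; apply: (subvP (JJ0 _)).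
    by apply: (subvP (GJ _)); apply: eJ.
  - move=> zx /memv_imgP[u uJ ->]; case: (ltngtP z x) zx => // [zx zN|-> _].
      by rewrite e_anticomm (Jkill _ z _ _ uJ) ?linear0 ?oppr0 //= zx.
    by rewrite e_sqr.
  - apply: limgS; apply: subv_trans (capvSl _ _) (GJ _).
  - move=> /memv_imgP[u uJ ->]; rewrite e_anticomm memvN memv_img //.
    by apply: eJG' => //; apply: ltnW.
  - move=> /memv_imgP[u uJ ->]; rewrite e_anticomm eJ0 ?oppr0 //.
    by apply: (subvP (GJ _)); apply: eJ => //; apply: ltnW.
  - by rewrite alS // memv_img // alG'.
have {}IH1 q : (q.+1 * \dim (J q.+1 :&: lker (e x))
     + \sum_(i | (nn i <= x)%N) na i * shift_bin (x - nn i) q (nb i)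
     <= (x - q) * \dim (G' q :&: lker (e x))%VS)%N.
  apply: IH1 => [|{}q|{}q z w|{}q|{}q y w yx|y w yx|i nix]; first exact: ltnW.
  - by apply: subv_trans (capvSl _ _) (JJ0 _).
  - rewrite memv_cap memv_ker => zx /andP[wJ /eqP wx].
    case: (ltngtP z x) zx => // [zx zN|-> //].
    by apply: Jkill wJ; rewrite zx.
  - by apply: capvS => //; apply: subv_trans (capvSl _ _) (GJ _).
  - rewrite !memv_cap !memv_ker => /andP[wJ /eqP wx].
    rewrite e_anticomm wx linear0 oppr0 eqxx andbT -memv_cap.
    by apply: eJG' => //; apply: ltnW.
  - by rewrite memv_cap => /andP[wJ _]; apply: eJ0 => //; apply: ltnW.
  - rewrite memv_cap memv_ker alS // e_sqr eqxx andbT.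
    apply: eJG' => //; apply: (subvP (GJ _)).
    by move: (alG' i nix); rewrite memv_cap => /andP[].
(* Each index of [S r] costs one dimension: [al i x.+1] lies in [G r] because
   [x.+1 - na i = nb i = r]. *)
have dG : (\dim (G' r) + size (S r) <= \dim (G r))%N.
  apply: (@capv_ker_dim _ _ _ _ _ _ (fun i => al i x.+1)).
  - by rewrite filter_uniq ?enum_uniq.
  - move=> i; rewrite mem_filter => /andP[/andP[/eqP ni /eqP bi] _].
    have := alG i; rewrite ni leqnn => /(_ isT).
    by rewrite -ni bi addnC addnK.
  - by move=> i; rewrite mem_filter => /andP[/andP[/eqP <- _] _].
  - move=> i j; rewrite mem_filter => /andP[/andP[/eqP <- _] _] _.
    exact: beta_al.
have dJ q : (\dim (J q :&: lker (e x)) + \dim (e x @: J q)%VS = \dim (J q))%N.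
  exact: limg_ker_dim.
have dG' q : (\dim (G' q :&: lker (e x)) + \dim (e x @: G' q)%VS
    = \dim (G' q))%N by exact: limg_ker_dim.
pose B q := (\sum_(i | (nn i <= x)%N) na i * shift_bin (x - nn i) q (nb i))%N.
pose B1 := if r is q.+1 then B q else 0%N.
(* Pascal's rule handles the indices with [nn i <= x]; each index of [S r] contributes
   [na i = x.+1 - r]. *)
have sumE : (\sum_(i | (nn i <= x.+1)%N) na i * shift_bin (x.+1 - nn i) r (nb i)
    = B r + B1 + (x.+1 - r) * size (S r))%N.
  rewrite (bigID (fun i => nn i <= x)%N) /=; congr addn.
    transitivity (\sum_(i | (nn i <= x)%N) (na i * shift_bin (x - nn i) r (nb i)
        + (if r is q.+1 then na i * shift_bin (x - nn i) q (nb i) else 0)))%N.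
      apply: eq_big => [i|i /andP[_ nix]].
        by case: (leqP (nn i) x) => nix; rewrite ?andbF // leqW.
      by rewrite subSn // shift_binS mulnDr; case: (r) => // *; rewrite muln0.
    rewrite big_split /=; congr addn; rewrite /B1.
    by case: (r) => [|q] //; rewrite big1.
  rewrite /S -sum1_size big_filter big_enum_cond /= big_distrr /=.
  rewrite big_mkcond [RHS]big_mkcond; apply: eq_bigr => i _ /=.
  rewrite -ltnNge -eqn_leq eq_sym; case: eqP => //= ni; rewrite ni subnn.
  rewrite /shift_bin bin0n; case: ltngtP => br; rewrite ?muln0 ?muln1 //.
    by rewrite subn_eq0 leqNgt br muln0.
  by rewrite -br subnn muln1 addnK.
(* The image instance pays for [r] copies of this dimension, while [r.+1] are needed. The missing
   one is charged to the kernel part of [G' r], whose coefficient grows from [x - r] to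
   [x.+1 - r]. *)
have le1 : (\dim (e x @: J r.+1) <= \dim (G' r :&: lker (e x)))%N.
  apply: dimvS; apply/subvP=> _ /memv_imgP[w wJ ->].
  by rewrite memv_cap memv_ker e_sqr eqxx eJG'.
have le0 : (r * \dim (e x @: J r.+1) + B1
    <= (x.+1 - r) * \dim (e x @: G' r)%VS)%N.
  by rewrite /B1; case: (r) => [|q] //; rewrite subSS; exact: IH0.
have := IH1 r; rewrite -/(B r) sumE -(dJ r.+1).
move: dG le1 le0; rewrite -(dG' r).
move: (\dim _) (\dim _) (\dim _) (\dim _) (\dim _).
nia.
Qed.

End Flux.

(** * Summing the weights of one pair *)

(** The right-hand side is the integral of t^(a-1) (1-t)^b over [0,1], and the left-hand side arises
    by inserting the expansion of (t + (1-t))^d. The induction on [d] inserts one factor at a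
    time. *)
Lemma sum_shift_bin (a b d : nat) : (0 < a)%N ->
  \sum_(r < a + b + d) (shift_bin d r b)%:R
     / ((a + b + d - r) * 'C(a + b + d, r))%:R
  = (a * 'C(a + b, a))%:R^-1 :> rat.
Proof.
elim: d a b => [|d IHd] a b a0.
  have bN : (b < a + b + 0)%N by lia.
  rewrite (bigD1 (Ordinal bN)) //= big1 => [|r rb].
    rewrite addr0 /shift_bin leqnn subnn bin0 addn0 addnK mul1r.
    by rewrite -{2}[b](addKn a) bin_sub ?leq_addr.
  rewrite /shift_bin bin0n; case: leqP => [br|]; rewrite ?mul0r // subn_eq0.
  rewrite (_ : (r <= b)%N = false) ?mul0r //; apply: contraNF rb => rb.
  by apply/eqP/val_inj/eqP; rewrite /= eqn_leq rb.
transitivity (\sum_(r < a + b + d.+1)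
    ((shift_bin d r b)%:R / ((a + b + d.+1 - r) * 'C(a + b + d.+1, r))%:R +
     (shift_bin d r b.+1)%:R
        / ((a + b + d.+1 - r) * 'C(a + b + d.+1, r))%:R) : rat).
  apply: eq_bigr => r _; rewrite -mulrDl -natrD shift_binS.
  by congr (_%:R / _); congr (_ + _)%N; case: (nat_of_ord r).
rewrite big_split /=.
transitivity ((a.+1 * 'C(a.+1 + b, a.+1))%:R^-1
    + (a * 'C(a + b.+1, a))%:R^-1 : rat).
  congr (_ + _); first by rewrite (_ : a + b + d.+1 = a.+1 + b + d)%N ?IHd //; lia.
  by rewrite (_ : a + b + d.+1 = a + b.+1 + d)%N ?IHd //; lia.
rewrite addSn addnS.
have h1 := mul_bin_diag (a + b).+1 a.
have h2 := mul_bin_left (a + b).+1 a.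
move: h1 h2; rewrite /= subSn ?leq_addr // addKn.
have c0 : ('C(a + b, a) > 0)%N by rewrite bin_gt0 leq_addr.
have c1 : ('C((a + b).+1, a) > 0)%N by rewrite bin_gt0 leqW ?leq_addr.
have c2 : ('C((a + b).+1, a.+1) > 0)%N by rewrite bin_gt0 ltnS leq_addr.
move: c0 c1 c2.
move: 'C(a + b, a) 'C((a + b).+1, a) 'C((a + b).+1, a.+1) => x y z x0 y0 z0.
move=> /(congr1 (fun k => k%:R : rat)) h1 /(congr1 (fun k => k%:R : rat)) h2.
move: h1 h2; rewrite !natrM -!natr1 natrD.
move=> h1 h2; have xn : x%:R != 0 :> rat by rewrite pnatr_eq0 -lt0n.
have an : a%:R != 0 :> rat by rewrite pnatr_eq0 -lt0n.
have bn : b%:R + 1 != 0 :> rat by rewrite natr1 pnatr_eq0.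
have an1 : a%:R + 1 != 0 :> rat by rewrite natr1 pnatr_eq0.
rewrite -h1 (_ : y%:R = (a%:R + b%:R + 1) * x%:R / (b%:R + 1)).
  have abn : a%:R + b%:R + 1 != 0 :> rat by rewrite -natrD natr1 pnatr_eq0.
  by field; rewrite an bn xn abn.
by rewrite h1 h2 mulrC mulKf.
Qed.

(** * General position over an infinite field *)

(** The injection [c] makes the field infinite. If [v] avoids [Us] but lies in [U], take [w] outside
    [U]: the points [w + c k *: v] all avoid [U], and each member of [Us] contains at most one of
    them. *)
Lemma avoid_subspaces (F : fieldType) (c : nat -> F) (V : vectType F)
    (Us : seq {vspace V}) : injective c -> {in Us, forall U, U != fullv} ->
  exists v, {in Us, forall U : {vspace V}, v \notin U}.
Proof.
move=> injc; elim: Us => [|U Us IHUs] proper; first by exists 0.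
have [v vUs] : exists v, {in Us, forall U : {vspace V}, v \notin U}.
  by apply: IHUs => X XUs; apply: proper; rewrite inE XUs orbT.
have [vU|vU] := boolP (v \in U); last first.
  by exists v => X; rewrite inE => /predU1P[->|/vUs].
have [w _ wU] : exists2 w, w \in fullv & w \notin U.
  apply/subvPn; apply: contra (proper U (mem_head _ _)) => fU.
  by rewrite eqEsubv subvf.
(* The value [size Us] means that no member of [Us] contains the point. *)
pose bad k := find (fun X : {vspace V} => w + c k *: v \in X) Us.
have [k kn] : exists k, bad k = size Us.
  pose s := map bad (iota 0 (size Us).+1).
  have [/hasP[k _ /eqP]|/hasPn no] :=
      boolP (has (fun k => bad k == size Us) (iota 0 (size Us).+1)).
    by exists k.
  suff : (size s <= size (iota 0 (size Us)))%N by rewrite size_map !size_iota ltnn.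
  have lt k : k \in iota 0 (size Us).+1 -> (bad k < size Us)%N.
    by move/no; rewrite ltn_neqAle find_size andbT.
  apply: uniq_leq_size => [|_ /mapP[k /lt ks ->]]; last by rewrite mem_iota.
  rewrite map_inj_in_uniq ?iota_uniq // => k l ks ls bkl.
  apply: injc; apply/eqP; rewrite -subr_eq0; apply: contraT => ckl.
  have := lt k ks; rewrite -has_find => /(nth_find U) bk.
  have := lt l ls; rewrite -has_find => /(nth_find U).
  rewrite -/(bad l) -bkl => bl.
  have := vUs _ (mem_nth U (lt k ks)); rewrite -(scalerK ckl v) scalerBl memvZ //.
  rewrite (_ : _ - _ = w + c k *: v - (w + c l *: v)) ?memvB //.
  by rewrite opprD addrACA subrr add0r.
exists (w + c k *: v) => X; rewrite inE => /predU1P[->|XUs].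
  by apply: contra wU => ?; rewrite -[w](addrK (c k *: v)) memvB // memvZ.
have /hasPn/(_ X XUs) // : ~~ has (fun X : {vspace V} => w + c k *: v \in X) Us.
by rewrite has_find -/(bad k) kn ltnn.
Qed.

(** The list grows at its head, each new vector lying outside every proper [C + <<t>>]. The
    invariant covers all tails, since subspaces of different dimensions use different tails. *)
Lemma generic_flag (F : fieldType) (c : nat -> F) (V : vectType F)
    (Cs : seq {vspace V}) : injective c ->
  exists2 t : seq V, size t = \dim {:V} &
    {in Cs, forall C : {vspace V}, (C + <<drop (\dim C) t>>)%VS = fullv}.
Proof.
move=> injc; set N := \dim {:V}.
suff ex d : exists2 t : seq V, size t = d &
    forall z, (z <= d)%N -> {in Cs, forall C : {vspace V},
      (minn N (\dim C + (d - z)) <= \dim (C + <<drop z t>>))%N}.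
  have [t tN Ct] := ex N; exists t => // C CCs; apply/eqP; rewrite eqEdim subvf /=.
  have CN : (\dim C <= N)%N by rewrite dimvS ?subvf.
  by have := Ct _ CN C CCs; rewrite subnKC // minnn.
elim: d => [|d [t td Ct]].
  exists [::] => // z; rewrite leqn0 => /eqP-> C CCs.
  by rewrite addn0 span_nil addv0 geq_minr.
pose Us := [seq U <- [seq (C + <<t>>)%VS | C <- Cs] | U != fullv].
have [v vUs] : exists v, {in Us, forall U : {vspace V}, v \notin U}.
  by apply: (avoid_subspaces injc) => U; rewrite mem_filter => /andP[].
exists (v :: t) => [|[|z] zd C CCs]; rewrite /= ?td //; last first.
  by rewrite subSS; apply: Ct.
have := Ct 0%N isT C CCs; rewrite drop0 !subn0 => le.
rewrite span_cons addvA [(C + _)%VS]addvC -addvA.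
have [full|nfull] := eqVneq (C + <<t>>)%VS fullv.
  by rewrite full addvf geq_minl.
have vC : v \notin (C + <<t>>)%VS.
  by apply: vUs; rewrite mem_filter nfull; apply/mapP; exists C.
rewrite dimv_disjoint_sum.
  have : v != 0 by apply: contraNneq vC => ->; rewrite mem0v.
  by rewrite dim_vline => ->; lia.
apply/eqP; rewrite -subv0; apply/subvP=> u; rewrite memv_cap memv0.
case/andP=> /vlineP[k ->]; have [->|k0] := eqVneq k 0; first by rewrite scale0r.
by rewrite memvE => kv; case/negP: vC; rewrite -(scalerK k0 v) memvZ.
Qed.

(** * The unweighted inequality *)

Lemma bollobas_subspaces (F : fieldType) (c : nat -> F) (V : vectType F)
    (I : finType) (A B : I -> {vspace V}) :
    injective c -> (forall i, (A i :&: B i = 0)%VS) ->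
    (forall i j, i != j -> (A i :&: B j != 0)%VS) ->
    (forall i, (0 < \dim (A i))%N) ->
  \sum_i ('C(\dim (A i) + \dim (B i), \dim (A i)))%:R^-1 <= 1 :> rat.
Proof.
move=> injc AB0 ABn0 A0.
pose N := \dim {:V}; pose a i := \dim (A i); pose b i := \dim (B i).
have [W [E0 [L ext0]]] := exterior_exists F N.
pose E (v : V) := E0 (rVof (vbasis {:V}) v).
have extE : exterior N E L.
  case: ext0 => Elin Esqr Edeg Eone Etop Ehigh Esoc.
  split=> // [k u v|v w|v p w|p w pN wp kill]; first by rewrite /E linearP Elin.
  - exact: Esqr.
  - exact: Edeg.
  apply: Esoc pN wp _ => v; rewrite -(vecofK (vbasisP fullv) v); exact: kill.
have dimC i : \dim (B i + A i) = (a i + b i)%N.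
  by rewrite dimv_disjoint_sum 1?addnC // capvC.
(* The zero subspace is listed so that [t] itself spans the space. *)
have [t tN Ct] := generic_flag (0%VS :: [seq B i + A i | i <- enum I]%VS) injc.
have tV : (<<t>> = fullv)%VS.
  by have := Ct 0%VS (mem_head _ _); rewrite dimv0 drop0 add0v.
have {}Ct i : (<<vbasis (B i) ++ drop (a i + b i) t ++ vbasis (A i)>> = fullv)%VS.
  rewrite !span_cat !(span_basis (vbasisP _)) [(<<_>> + _)%VS]addvC addvA -dimC.
  apply: Ct; rewrite inE; apply/orP; right; apply/mapP.
  by exists i; rewrite ?mem_enum.
have [w1 w1L w1n0] := ext_one extE.
(* [beta i] multiplies by ω(B_i), [alpha i] is ω(A_i) times the degree-zero element [w1], and [M p]
   is the degree [p] part of the ideal I. *)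
pose beta i := wedge E (vbasis (B i)).
pose alpha i := wedge E (vbasis (A i)) w1.
pose e z := E t`_z.
pose al i x := wedge E (drop x t) (alpha i).
pose M p := (L p :&:
  \bigcap_i \bigcap_(v <- vbasis (A i)) lker (E v \o beta i))%VS.
have memM p w : reflect
    (w \in L p /\ forall i v, v \in vbasis (A i) -> E v (beta i w) = 0)
    (w \in M p).
  rewrite memv_cap memv_bigcap_seq; apply: (iffP andP) => -[wL wM]; split=> //.
    move=> i v vA; have := allP wM i (mem_index_enum i).
    rewrite memv_bigcap_seq => /allP/(_ v vA).
    by rewrite memv_ker comp_lfunE => /eqP.
  apply/allP=> i _; rewrite memv_bigcap_seq; apply/allP=> v vA.
  by rewrite memv_ker comp_lfunE wM.
pose J r := if (r <= N)%N then M (N - r)%N else 0%VS.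
have bN i : (a i + b i <= N)%N by rewrite -dimC dimvS ?subvf.
have anti := ext_anticomm extE; have sqr := ext_sqr extE.
(* The factors include bases of B_i and A_j, which are dependent since these spaces meet. *)
have wedge_AB i j s w : i != j ->
    wedge E (vbasis (B i)) (wedge E s (wedge E (vbasis (A j)) w)) = 0.
  move=> ij; rewrite -!wedge_cat; apply: (wedge_nfree extE).
  rewrite eq_sym in ij; move: (ABn0 j i ij); apply: contra.
  rewrite -?catA; have /perm_free -> : perm_eq (vbasis (B i) ++ s ++ vbasis (A j))
      (s ++ vbasis (B i) ++ vbasis (A j)) by rewrite perm_catCA.
  move/catr_free.
  rewrite cat_free !(span_basis (vbasisP _)) => /and3P[_ _ /directv_addP].
  by rewrite capvC => ->.
have M_closed p u w : w \in M p -> E u w \in M p.+1.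
  move=> /memM[wL wM]; apply/memM; split; first exact: (ext_deg extE).
  move=> i v vA; rewrite (wedge_ext extE) linearZ /= anti wM //.
  by rewrite linear0 oppr0 scaler0.
have alphaM i : alpha i \in M (a i).
  apply/memM; split.
    by have := wedge_deg extE (vbasis (A i)) w1L; rewrite size_tuple addn0.
  move=> j v vA; have [ji|ji] := eqVneq j i.
    rewrite /beta /alpha -wedge_cat (wedge_span0 extE) //.
    by rewrite span_cat (span_basis (vbasisP (A i))) -ji memvE addvC;
      apply: subv_trans (addvSl _ _); rewrite -memvE vbasis_mem.
  have := wedge_AB _ _ [::] w1 ji; rewrite wedge_nil => h.
  by rewrite /beta /alpha h linear0.
have flux_ineq r : (r < N)%N -> (r.+1 * \dim (J r.+1)
    + \sum_i a i * shift_bin (N - (a i + b i)) r (b i)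
    <= (N - r) * \dim (J r))%N.
  move=> rN.
  (* At stage [N] no flag vector has been used, so [G] is [J] itself. *)
  have := @flux _ W I N a b e beta al J _ _ _ _ _ _ _ N J J (leqnn N) _ _ _ _ _ _ r.
  under eq_bigl do rewrite bN.
  apply => //.
  - by move=> x y w; apply: anti.
  - by move=> x w; apply: sqr.
  - by move=> i x xN; rewrite /al (drop_nth 0) ?wedge_cons // tN.
  - by move=> i j ij; apply: wedge_AB.
  (* Bases of B_i and A_i and the tail of the flag have [N] members in all and span the space. *)
  - move=> i; rewrite /beta /al /alpha -!wedge_cat -?catA.
    apply: (@wedge_neq0 _ _ _ _ _ _ extE _ [::] 0) => //; last by rewrite cats0.
    by rewrite !size_cat size_drop !size_tuple tN; have := bN i; rewrite /a /b; lia.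
  - move=> q w q0; rewrite /J; case: leqP => [qN /memM[wL _] kill|_].
      apply: (ext_socle_span extE _ wL tV); first by lia.
      by move=> v /(nthP 0)[z zN <-]; apply: kill; rewrite /N -tN.
    by rewrite memv0 => /eqP.
  - move=> i w y; rewrite /J; case: ifP => [bN' /memM[wL wM] kill|_]; last first.
      by rewrite memv0 => /eqP-> _; rewrite !linear0.
    (* This vector has degree [N - 1] and is killed by B_i, the tail of the flag and A_i, which
       together span the space. *)
    suff bw : beta i w = 0.
      by rewrite /beta (wedge_ext extE) -/(beta i) bw linear0 scaler0.
    have := wedge_deg extE (vbasis (B i)) wL; rewrite size_tuple -/(b i) => bL.
    apply: (ext_socle_span extE _ bL (Ct i)); first by lia.
    move=> v; rewrite !mem_cat => /or3P[vB|/(nthP 0)[z]|/wM //].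
      by apply: (wedge_span0 extE); apply: memv_span.
    rewrite size_drop nth_drop tN => zN <-; apply: (wedge_kill extE).
    by apply: kill; rewrite leq_addr /= /N; lia.
  - by move=> q z w /andP[Nz zN]; move: (leq_trans zN Nz); rewrite ltnn.
  - move=> q y w _; rewrite /J; case: ifP => qN; last first.
      by rewrite memv0 => /eqP->; rewrite linear0 mem0v.
    by rewrite ltnW // -(subnSK qN); apply: M_closed.
  - move=> y w _; rewrite /J leq0n subn0 => /M_closed-/(_ t`_y)/memM[].
    by rewrite (ext_high extE) // memv0 => /eqP.
  - move=> i _; rewrite /J leq_subr subKn; last first.
      exact: leq_trans (leq_addr _ _) (bN i).
    by rewrite /al drop_oversize ?tN // wedge_nil.
have J01 : (\dim (J 0) <= 1)%N.
  apply: leq_trans (ext_top extE); apply: dimvS; rewrite /J subn0.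
  exact: capvSl.
pose v r : rat := (\dim (J r))%:R / 'C(N, r)%:R.
(* Dividing by [(N - r) * 'C(N, r)], which equals [r.+1 * 'C(N, r.+1)], turns both dimensions into
   the densities [v], ready to telescope. *)
have step r : (r < N)%N ->
    \sum_i (a i)%:R * ((shift_bin (N - (a i + b i)) r (b i))%:R
        / ((N - r) * 'C(N, r))%:R)
      <= v r - v r.+1.
  move=> rN; have := flux_ineq r rN.
  have Nr : (N - r)%:R != 0 :> rat by rewrite pnatr_eq0 subn_eq0 -ltnNge.
  have c0 : (0 < (N - r) * 'C(N, r))%N.
    by rewrite muln_gt0 subn_gt0 rN bin_gt0 ltnW.
  have -> : v r = ((N - r) * \dim (J r))%:R / ((N - r) * 'C(N, r))%:R.
    by rewrite /v !natrM invfM mulrACA divff ?mul1r.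
  have -> : v r.+1 = (r.+1 * \dim (J r.+1))%:R / ((N - r) * 'C(N, r))%:R.
    rewrite -mul_bin_left /v !natrM invfM mulrACA divff ?mul1r //.
    by rewrite pnatr_eq0.
  rewrite -(ler_nat rat) natrD natr_sum -mulrBl.
  under [in X in _ -> X]eq_bigr do rewrite mulrA -natrM.
  by rewrite -mulr_suml ler_pM2r ?invr_gt0 ?ltr0n // lerBrDl.
have : \sum_(r < N) \sum_i (a i)%:R *
    ((shift_bin (N - (a i + b i)) r (b i))%:R / ((N - r) * 'C(N, r))%:R)
    <= 1 :> rat.
  apply: le_trans (_ : v 0%N <= 1); last first.
    by rewrite /v bin0 divr1 lern1.
  apply: le_trans (_ : \sum_(0 <= r < N) (v r - v r.+1) <= _).
    by rewrite big_mkord; apply: ler_sum => r _; apply: step.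
  rewrite (eq_bigr (fun r => - (v r.+1 - v r))) => [|r _]; last by rewrite opprB.
  by rewrite sumrN telescope_sumr // opprB lerBlDr lerDl /v divr_ge0.
rewrite exchange_big /=; apply: le_trans; apply: ler_sum => i _.
rewrite -mulr_sumr.
have := sum_shift_bin (b i) (N - (a i + b i)) (A0 i).
rewrite -/(a i) subnKC // => ->.
by rewrite natrM invfM mulVKf ?pnatr_eq0 -?lt0n ?A0.
Qed.

(** * Extension of scalars and generic sections *)

Lemma mx_vspaces (F : fieldType) (n : nat) (T : Type) (M : T -> 'M[F]_n) :
  exists (V : vectType F) (U : T -> {vspace V}),
    (forall x, \dim (U x) = \rank (M x)) /\
    (forall x y, \dim (U x :&: U y) = \rank (M x :&: M y)%MS).
Proof.
have [V dV] : exists V : vectType F, dim V = n.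
  by exists 'rV[F]_n; apply: etrans (dim_matrix _ _ _) (mul1n n).
case: n / dV M => M; exists V, (fun x => VectorInternalTheory.mx2vs (M x)).
have mxK := @VectorInternalTheory.mx2vsK F V; split=> [x|x y].
  by rewrite /dimv mxK.
by rewrite /dimv /capv mxK (cap_eqmx (mxK _ _) (mxK _ _)).
Qed.

(** Over the rational functions the powers of X are distinct, and extending scalars preserves ranks
    and intersections of row spaces. *)
Lemma infinite_extension (F : fieldType) (V : vectType F) :
  exists (F' : fieldType) (c : nat -> F') (V' : vectType F')
      (f : {vspace V} -> {vspace V'}),
    [/\ injective c, forall U, \dim (f U) = \dim U &
      forall U1 U2, \dim (f U1 :&: f U2) = \dim (U1 :&: U2)].
Proof.
pose F' : fieldType := {fraction {poly F}}.
pose g : {rmorphism F -> F'} := @tofrac {poly F} \o polyC.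
have [V' [f [df df2]]] :=
  mx_vspaces (fun U : {vspace V} => map_mx g (VectorInternalTheory.vs2mx U)).
exists F', (fun n => tofrac ('X^n)), V', f; split=> [k l|U|U1 U2].
- move/eqP; rewrite tofrac_eq => /eqP/(congr1 (fun u : {poly F} => size u)).
  by rewrite !size_polyXn => -[].
- by rewrite df mxrank_map.
- rewrite df2 -map_capmx mxrank_map /dimv /capv.
  by rewrite VectorInternalTheory.mx2vsK.
Qed.

(** One hyperplane at a time: [lker f] lowers a nonzero [U :&: H] by exactly one dimension once [f]
    is nonzero at a chosen vector of it. Each such vector excludes a proper subspace of linear
    forms. *)
Lemma generic_section (F : fieldType) (c : nat -> F) (V : vectType F)
    (Us : seq {vspace V}) (t : nat) : injective c ->
  exists H : {vspace V},
    {in Us, forall U : {vspace V}, \dim (U :&: H) = (\dim U - t)%N}.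
Proof.
move=> injc; elim: t => [|t [H dH]].
  by exists fullv => U _; rewrite capvf subn0.
pose ev (x : V) : 'Hom('Hom(V, F^o), F^o) :=
  linfun (fun f : 'Hom(V, F^o) => f x).
have evE x f : ev x f = f x.
  rewrite linfun_linearE // => k f1 f2; by rewrite add_lfunE scale_lfunE.
pose Xs := [seq lker (ev (vpick (U :&: H))) | U <- Us & (U :&: H != 0)%VS].
have [f fXs] : exists f, {in Xs, forall X : {vspace 'Hom(V, F^o)}, f \notin X}.
  apply: (avoid_subspaces injc) => X /mapP[U].
  rewrite mem_filter => /andP[UH _] ->.
  have [g] := linear_of_free [:: vpick (U :&: H)] [:: 1 : F^o].
  rewrite seq1_free vpick0 => /(_ UH erefl)/= gE.
  have {gE} g1 : g (vpick (U :&: H)) = 1 by case: gE.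
  apply/eqP => /vspaceP/(_ (linfun g)).
  by rewrite memvf memv_ker evE lfunE g1 oner_eq0.
exists (H :&: lker f)%VS => U UUs; rewrite capvA.
have := limg_ker_dim f (U :&: H); rewrite dH //.
have [U0|UH] := eqVneq (U :&: H)%VS 0%VS.
  have := dH _ UUs; rewrite U0 dimv0 cap0v dimv0; lia.
suff -> : \dim (f @: (U :&: H)) = 1%N by lia.
apply/eqP; rewrite eqn_leq; apply/andP; split.
  by apply: leq_trans (dimvS (subvf _)) _; rewrite dimvf.
rewrite lt0n dimv_eq0; apply/eqP => f0.
have := memv_img f (memv_pick (U :&: H)); rewrite f0 memv0 => /eqP fx.
have := fXs (lker (ev (vpick (U :&: H)))).
rewrite memv_ker evE fx eqxx => /(_ _)/negP; apply=> //.
by apply/mapP; exists U; rewrite // mem_filter UH.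
Qed.

(** * Absorbing the weights by exchanging basis vectors *)

Section SubBasis.

Variables (F : fieldType) (V : vectType F).
Implicit Types (U : {vspace V}) (k : 'I_(\dim {:V})).
Implicit Types (S : {set 'I_(\dim {:V})}).

(* Subfamilies of [vbasis U] are indexed by sets of positions in a type that
   does not depend on [U]; only the positions in [positions U] are meaningful. *)
Definition positions U := [set k : 'I_(\dim {:V}) | (k < \dim U)%N].
Definition sub_basis U S := <<[seq (vbasis U)`_k | k in S]>>%VS.

Lemma card_positions U : #|positions U| = \dim U.
Proof.
rewrite -sum1_card; under eq_bigl do rewrite inE.
by rewrite -(big_ord_widen _ (fun=> 1%N)) ?dimvS ?subvf // sum1_card card_ord.
Qed.

Lemma dim_sub_basis U S : (\dim (sub_basis U S) <= #|S|)%N.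
Proof. by apply: leq_trans (dim_span _) _; rewrite size_map -cardE. Qed.

Lemma mem_sub_basis U S k : k \in S -> (vbasis U)`_k \in sub_basis U S.
Proof. by move=> kS; apply/memv_span/mapP; exists k; rewrite ?mem_enum. Qed.

Lemma sub_basis_neq0 U k : k \in positions U -> (vbasis U)`_k != 0.
Proof.
rewrite inE => kU; apply: (basis_not0 (vbasisP U)).
by rewrite mem_nth ?size_tuple.
Qed.

Lemma sub_basis_sub U S : S \subset positions U -> (sub_basis U S <= U)%VS.
Proof.
move=> /subsetP SU; apply/span_subvP=> v /mapP[k].
rewrite mem_enum => /SU; rewrite inE => kU ->.
by apply: vbasis_mem; rewrite mem_nth ?size_tuple.
Qed.

Lemma sub_basis_cover U S :
  (U <= sub_basis U (positions U :\: S) + sub_basis U S)%VS.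
Proof.
rewrite -{1}(span_basis (vbasisP U)); apply/span_subvP=> v /(nthP 0)[k].
rewrite size_tuple => kU <-.
have kV : (k < \dim {:V})%N by apply: leq_trans kU _; rewrite dimvS ?subvf.
have [kS|kS] := boolP (Ordinal kV \in S).
  by apply: (subvP (addvSr _ _)); have := mem_sub_basis U kS.
apply: (subvP (addvSl _ _)); apply: (@mem_sub_basis U _ (Ordinal kV)).
by rewrite !inE kS.
Qed.

End SubBasis.

(** In an index [(i, (l, (P, Q)))], [P] moves from A_i to B_i and [Q] moves back. The dimension of
    [A'] does not depend on [l], so all the pairs coming from one [i] have the same weight, and
    [Hpq] counts them. *)
Lemma Hpq_bollobas (F : fieldType) (c : nat -> F) (V : vectType F)
    (I : finType) (A B : I -> {vspace V}) (s p q : nat) :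
    injective c -> (forall i, (A i :&: B i = 0)%VS) ->
    (forall i j, i != j -> (s < \dim (A i :&: B j))%N) ->
    (forall i, (s < \dim (A i))%N) -> (p + q <= s)%N ->
  \sum_i (Hpq p q (\dim (A i)) (\dim (B i)))%:R
     / 'C(\dim (A i) + \dim (B i), \dim (A i) + q - p)%:R <= 1 :> rat.
Proof.
move=> injc AB0 ABs As pqs; pose D := \dim {:V}.
pose T := (I * ('I_(minn p q).+1 * ({set 'I_D} * {set 'I_D})))%type.
pose ok (x : T) := [&& x.2.2.1 \subset positions (A x.1),
  #|x.2.2.1| == (p - x.2.1)%N, x.2.2.2 \subset positions (B x.1)
  & #|x.2.2.2| == (q - x.2.1)%N].
pose A' (x : T) := (sub_basis (A x.1) (positions (A x.1) :\: x.2.2.1)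
  + sub_basis (B x.1) x.2.2.2)%VS.
pose B' (x : T) := (sub_basis (B x.1) (positions (B x.1) :\: x.2.2.2)
  + sub_basis (A x.1) x.2.2.1)%VS.
have card_compl U (S : {set 'I_D}) : S \subset positions U ->
    (#|positions U :\: S| + #|S| = \dim U)%N.
  move=> SU; rewrite cardsDS // card_positions subnK //.
  by rewrite -(card_positions U) subset_leq_card.
have okP x : ok x -> [/\ \dim (A' x) = (\dim (A x.1) + q - p)%N,
    (\dim (A' x) + \dim (B' x) = \dim (A x.1) + \dim (B x.1))%N
    & (A' x :&: B' x = 0)%VS].
  case: x => i [l [P Q]]; rewrite /ok /= => /and4P[PA /eqP cP QB /eqP cQ].
  set X := A' _; set Y := B' _.
  have cX : (\dim X <= \dim (A i) - #|P| + #|Q|)%N.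
    apply: leq_trans (dimv_add_leqif _ _) _; apply: leq_add (dim_sub_basis _ _).
    by apply: leq_trans (dim_sub_basis _ _) _; rewrite -(card_compl _ _ PA) addnK.
  have cY : (\dim Y <= \dim (B i) - #|Q| + #|P|)%N.
    apply: leq_trans (dimv_add_leqif _ _) _; apply: leq_add (dim_sub_basis _ _).
    by apply: leq_trans (dim_sub_basis _ _) _; rewrite -(card_compl _ _ QB) addnK.
  (* The bounds [cX] and [cY] add up to the dimension of A_i + B_i, so they are equalities and the
     intersection is zero. *)
  have XY : (A i + B i <= X + Y)%VS.
    rewrite /X /Y /A' /B' /= subv_add; apply/andP; split.
      apply: subv_trans (sub_basis_cover _ P) _.
      by apply: addvS; [apply: addvSl | apply: addvSr].
    apply: subv_trans (sub_basis_cover _ Q) _.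
    by rewrite addvC; apply: addvS; [apply: addvSr | apply: addvSl].
  have := dimvS XY; rewrite dimv_disjoint_sum // => {}XY.
  have h0 := dimv_sum_cap X Y; have h1 := card_compl _ _ PA.
  have h2 := card_compl _ _ QB; have h3 := As i.
  have pl : (l <= p)%N by have := ltn_ord l; rewrite ltnS leq_min => /andP[].
  have ql : (l <= q)%N by have := ltn_ord l; rewrite ltnS leq_min => /andP[].
  have [eX eXY e0] : [/\ \dim X = \dim (A i) + q - p,
      \dim X + \dim Y = \dim (A i) + \dim (B i) & \dim (X :&: Y) = 0]%N.
    move: cX cY XY h0 h1 h2 h3 cP cQ pl ql.
    move: (\dim X) (\dim Y) (\dim (X + Y)) (\dim (X :&: Y)) => x y xy z.
    by move: #|_| #|_| #|_| #|_| (\dim _) (\dim _); split; lia.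
  by split=> //; apply/eqP; rewrite -dimv_eq0 e0.
have cap x y : ok x -> ok y -> x != y -> (A' x :&: B' y != 0)%VS.
  case: x => i [l [P Q]]; case: y => j [l' [P' Q']].
  rewrite /ok /= => /and4P[PA /eqP cP QB /eqP cQ] /and4P[PA' /eqP cP' QB' /eqP cQ'].
  have [ij|ij _] := eqVneq i j.
    subst j => ne.
    have capn0 (U1 U2 : {vspace V}) v : v \in U1 -> v \in U2 -> v != 0 ->
        (U1 :&: U2 != 0)%VS.
      by move=> vU1 vU2; apply: contraNneq => U0; rewrite -memv0 -U0 memv_cap vU1.
    (* A vector of [P'] outside [P], or of [Q] outside [Q'], lies in both spaces. If there is none,
       comparing cardinals gives [l = l'] and the two indices coincide. *)
    have [PP|/subsetPn[k kP' kP]] := boolP (P' \subset P); last first.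
      have kA := subsetP PA' k kP'.
      apply: capn0 (sub_basis_neq0 kA); rewrite memvE.
        apply: subv_trans (addvSl _ _); rewrite -memvE mem_sub_basis //.
        by rewrite inE kP.
      by apply: subv_trans (addvSr _ _); rewrite -memvE mem_sub_basis.
    have [QQ|/subsetPn[k kQ kQ']] := boolP (Q \subset Q'); last first.
      have kB := subsetP QB k kQ.
      apply: capn0 (sub_basis_neq0 kB); rewrite memvE.
        by apply: subv_trans (addvSr _ _); rewrite -memvE mem_sub_basis.
      apply: subv_trans (addvSl _ _); rewrite -memvE mem_sub_basis //.
      by rewrite inE kQ'.
    have := subset_leq_card PP; have := subset_leq_card QQ.
    rewrite cP cP' cQ cQ' => le1 le2.
    have := ltn_ord l; have := ltn_ord l'; rewrite !ltnS !leq_min.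
    move=> /andP[l'p l'q] /andP[lp lq].
    have ll : nat_of_ord l = l' by lia.
    case/eqP: ne; rewrite (val_inj ll); congr (_, (_, (_, _))).
      by apply/eqP; rewrite eq_sym eqEcard PP cP cP' ll leqnn.
    by apply/eqP; rewrite eqEcard QQ cQ cQ' ll leqnn.
  rewrite -dimv_eq0 -lt0n.
  (* The vectors left in place suffice: the intersection loses at most [(p - l) + (q - l')]
     dimensions, hence at most [s]. *)
  pose X := sub_basis (A i) (positions (A i) :\: P).
  pose Y := sub_basis (B j) (positions (B j) :\: Q').
  apply: leq_trans (dimvS (capvS (addvSl X _) (addvSl Y _))).
  have dX : (\dim (A i) <= \dim X + #|P|)%N.
    apply: leq_trans (dimvS (sub_basis_cover _ P)) _.
    by apply: leq_trans (dimv_add_leqif _ _) _; rewrite leq_add2l dim_sub_basis.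
  have dY : (\dim (B j) <= \dim Y + #|Q'|)%N.
    apply: leq_trans (dimvS (sub_basis_cover _ Q')) _.
    by apply: leq_trans (dimv_add_leqif _ _) _; rewrite leq_add2l dim_sub_basis.
  have XY : (\dim (X + Y) <= \dim (A i + B j))%N.
    by apply/dimvS/addvS; apply: sub_basis_sub; apply: subsetDl.
  move: (dimv_sum_cap X Y) (dimv_sum_cap (A i) (B j)) (ABs i j ij) dX dY XY.
  rewrite cP cQ'; move: (\dim _) (\dim _) (\dim _) (\dim _).
  by move: (\dim _) (\dim _) (\dim _) (\dim _); lia.
have := @bollobas_subspaces F c V {x | ok x}
  (fun x => A' (val x)) (fun x => B' (val x)) injc.
have -> : \sum_i (Hpq p q (\dim (A i)) (\dim (B i)))%:R
     / 'C(\dim (A i) + \dim (B i), \dim (A i) + q - p)%:R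
   = \sum_(x : {x | ok x}) ('C(\dim (A' (val x)) + \dim (B' (val x)),
        \dim (A' (val x))))%:R^-1 :> rat.
  have HpqE i : Hpq p q (\dim (A i)) (\dim (B i)) = (\sum_(y | ok (i, y)) 1)%N.
    transitivity (\sum_(l < (minn p q).+1) \sum_(PQ | ok (i, (l, PQ))) 1)%N; last first.
      by rewrite pair_big_dep /=; apply: eq_big => -[].
    apply: eq_bigr => l _; rewrite -card_positions -cards_draws.
    rewrite -(card_positions (B i)) -cards_draws -cardsX -sum1_card.
    by apply: eq_bigl => -[P Q]; rewrite /ok !inE /= -!andbA.
  transitivity (\sum_(x | ok x) ('C(\dim (A x.1) + \dim (B x.1),
      \dim (A x.1) + q - p))%:R^-1 : rat).
    transitivity (\sum_i \sum_(y | ok (i, y)) ('C(\dim (A i) + \dim (B i),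
      \dim (A i) + q - p))%:R^-1 : rat).
      apply: eq_bigr => i _; rewrite HpqE natr_sum mulr_suml.
      by apply: eq_bigr => y _; rewrite mul1r.
    by rewrite pair_big_dep /=; apply: eq_big => -[].
  rewrite -(big_sub_cond ok xpredT (fun x => ('C(\dim (A' x) + \dim (B' x),
        \dim (A' x)))%:R^-1 : rat)).
  by apply: eq_big => x; rewrite ?andbT // => okx; case: (okP x okx) => -> -> _.
apply.
- by move=> [x okx] /=; case: (okP x okx).
- by move=> [x okx] [y oky] xy /=; apply: cap.
- move=> [x okx] /=; case: (okP x okx) => -> _ _; move: (As x.1).
  by move: (\dim _); lia.
Qed.

(** * From sets to subspaces, and the conclusion *)

(** The spaces of [S] and of its complement in [X] together span, so the cardinality bounds on their
    dimensions are attained; intersections follow from the dimension formula. Elements outside [X]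
    give the default vector 0. *)
Lemma coordinate_subspaces (F : fieldType) (K : choiceType) (X : {fset K}) :
  exists (V : vectType F) (f : {fset K} -> {vspace V}),
    (forall S, (S `<=` X)%fset -> \dim (f S) = #|` S|) /\
    (forall S T, (S `<=` X)%fset -> (T `<=` X)%fset ->
       \dim (f S :&: f T) = #|` (S `&` T)%fset|).
Proof.
pose n := #|` X|; pose V := 'rV[F]_n.
have dV : \dim {:V} = n by rewrite dimvf; apply: etrans (dim_matrix _ _ _) (mul1n n).
pose d x : V := (vbasis {:V})`_(index x X).
pose f (S : {fset K}) := <<[seq d x | x <- S]>>%VS.
have lef S : (\dim (f S) <= #|` S|)%N.
  by apply: leq_trans (dim_span _) _; rewrite size_map.
have fU S T : (f S + f T)%VS = f (S `|` T)%fset.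
  rewrite /f -span_cat -map_cat; apply: eq_span => v.
  apply/mapP/mapP => -[x xST ->]; exists x => //; move: xST;
    by rewrite mem_cat in_fsetU.
have fX : f X = fullv.
  apply/eqP; rewrite eqEsubv subvf -{1}(span_basis (vbasisP {:V})).
  apply/span_subvP=> v /(nthP 0)[k]; rewrite size_tuple => kV <-.
  have kn : (k < n)%N by rewrite -dV.
  apply/memv_span/mapP.
  have [x0 x0X] : exists x0, x0 \in X.
    by apply/fset0Pn; rewrite -cardfs_gt0; apply: leq_ltn_trans kn.
  by exists (nth x0 X k); rewrite /d ?mem_nth // index_uniq.
have df S : (S `<=` X)%fset -> \dim (f S) = #|` S|.
  move=> SX; apply/eqP; rewrite eqn_leq lef /=.
  have XS : (S `|` X `\` S = X)%fset by rewrite -{1}(fsetIidPr SX) fsetID.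
  have [le _] := dimv_add_leqif (f S) (f (X `\` S)%fset).
  move: le; rewrite fU XS fX dV /n.
  have := lef (X `\` S)%fset; have := cardfsDS SX; have := fsubset_leq_card SX.
  by move: #|` _| #|` _| #|` _| (\dim _) (\dim _); lia.
exists V, f; split=> // S T SX TX.
have := dimv_sum_cap (f S) (f T); rewrite fU !df ?fsubUset ?SX ?TX //.
by rewrite -cardfsUI => /addnI.
Qed.

(* For 2 <= m the hypotheses give a i, b i >= t + s + 1, so the natural number
   subtractions a i - t, b i - t and (alpha i + q) - p are never truncated. *)
Theorem corollary5p3 (t s m : nat) (hm : (2 <= m)%N) (a b : 'I_m -> nat)
  (hab :
    (exists (K : choiceType) (A B : 'I_m -> {fset K}),
      [/\ forall i, (#|` (A i `&` B i)%fset | <= t)%N,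
          forall i j, i != j -> (#|` (A i `&` B j)%fset | > t + s)%N,
          forall i, a i = #|` A i |
        & forall i, b i = #|` B i |])
    \/
    (exists (F : fieldType) (vT : vectType F) (A B : 'I_m -> {vspace vT}),
      [/\ forall i, (\dim (A i :&: B i)%VS <= t)%N,
          forall i j, i != j -> (\dim (A i :&: B j)%VS > t + s)%N,
          forall i, a i = \dim (A i)
        & forall i, b i = \dim (B i)])) :
  let alpha := fun i : 'I_m => (a i - t)%N in
  let beta := fun i : 'I_m => (b i - t)%N in
  (forall p q : nat, (p + q <= s)%N ->
    \sum_(i < m) (Hpq p q (alpha i) (beta i))%:R
                 / 'C(alpha i + beta i, alpha i + q - p)%:R <= 1 :> rat)
  /\
  (forall r : nat, (2 * r <= s)%N ->
    \sum_(i < m) (\sum_(j < r.+1) 'C(alpha i, j) * 'C(beta i, j))%N%:R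
                 / 'C(alpha i + beta i, alpha i)%:R <= 1 :> rat).
Proof.
move=> alpha beta.
have [F [V [A [B [dAB dABn dA dB]]]]] : exists (F : fieldType) (V : vectType F)
    (A B : 'I_m -> {vspace V}),
    [/\ forall i, (\dim (A i :&: B i)%VS <= t)%N,
        forall i j, i != j -> (\dim (A i :&: B j)%VS > t + s)%N,
        forall i, a i = \dim (A i) & forall i, b i = \dim (B i)].
  case: hab => [[K [A [B [AB ABn aA bB]]]]|//].
  pose X := (\bigcup_(i <- enum 'I_m) (A i `|` B i))%fset.
  have ABX i : (A i `|` B i `<=` X)%fset.
    by apply: bigfcup_sup; rewrite ?mem_enum.
  have AX i := fsubset_trans (fsubsetUl (A i) (B i)) (ABX i).
  have BX i := fsubset_trans (fsubsetUr (A i) (B i)) (ABX i).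
  have [V [f [df df2]]] := coordinate_subspaces rat X.
  exists rat, V, (f \o A), (f \o B); split=> /= [i|i j ij|i|i].
  - by rewrite df2.
  - by rewrite df2 // ABn.
  - by rewrite df.
  - by rewrite df.
have [F' [c [V' [f [injc df df2]]]]] := infinite_extension V.
(* The pairwise intersections are listed too, so that a single [H] lowers every dimension in the
   hypotheses by [t], stopping at 0. *)
pose Us := [seq f (A i) | i <- enum 'I_m] ++ [seq f (B i) | i <- enum 'I_m]
  ++ [seq (f (A x.1) :&: f (B x.2))%VS | x <- enum {: 'I_m * 'I_m}].
have [H dH] := generic_section Us t injc.
pose A' i := (f (A i) :&: H)%VS; pose B' i := (f (B i) :&: H)%VS.
have dA' i : \dim (A' i) = alpha i.
  rewrite dH ?df -?dA // mem_cat; apply/orP; left.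
  by apply/mapP; exists i; rewrite ?mem_enum.
have dB' i : \dim (B' i) = beta i.
  rewrite dH ?df -?dB // !mem_cat; apply/orP; right; apply/orP; left.
  by apply/mapP; exists i; rewrite ?mem_enum.
have dAB' i j : \dim (A' i :&: B' j) = (\dim (A i :&: B j) - t)%N.
  rewrite /A' /B' -capvA [(H :&: _)%VS]capvC -capvA capvv capvA dH ?df2 //.
  rewrite !mem_cat; apply/orP; right; apply/orP; right.
  by apply/mapP; exists (i, j); rewrite ?mem_enum.
have cap_n0 i j : i != j -> (s < \dim (A' i :&: B' j))%N.
  by move=> ij; rewrite dAB' ltn_subRL dABn.
have alpha_s i : (s < alpha i)%N.
  (* Another index exists because [m] is at least 2. *)
  have [j ij] : exists j : 'I_m, i != j.
    have [->|i0] := eqVneq i (Ordinal (ltnW hm)); first by exists (Ordinal hm).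
    by exists (Ordinal (ltnW hm)).
  by rewrite -dA'; apply: leq_trans (cap_n0 i j ij) (dimvS (capvSl _ _)).
have main p q : (p + q <= s)%N ->
    \sum_(i < m) (Hpq p q (alpha i) (beta i))%:R
                 / 'C(alpha i + beta i, alpha i + q - p)%:R <= 1 :> rat.
  move=> pqs; under eq_bigr do rewrite -dA' -dB'.
  apply: (@Hpq_bollobas F' c V' _ A' B' s) => // i; last by rewrite dA'.
  by apply/eqP; rewrite -dimv_eq0 dAB' subn_eq0.
(* Take [p = q = r] and reverse the summation by [j = r - l]. *)
split=> // r r2s; have := main r r; rewrite addnn -mul2n => /(_ r2s).
congr (_ <= _); apply: eq_bigr => i _; rewrite addnK; congr (_%:R / _).
rewrite /Hpq minnn (reindex_inj rev_ord_inj) /=; apply: eq_bigr => j _.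
by rewrite subSS subKn // -ltnS.
Qed.
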